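(* Let $r$ be a positive integer. Then $$PC_r(x_1,\dots,x_r) = \frac{Q_r(x_1,\dots,x_r)}{\prod_{i=1}^r \left(1 - \prod_{j=1}^i x_j^{1+i-j}\right)},$$ where $Q_r(x_1,\dots,x_r)$ is a polynomial satisfying: (i) $Q_r(x_1,\dots,x_r)$ has integer coefficients; (ii) $Q_r(1,\dots,1)=1$; (iii) all exponent vectors of the monomials that occur in $Q_r$ are weakly decreasing (i.e. if $x_1^{a_1}\cdots x_r^{a_r}$ occurs in $Q_r$ with nonzero coefficient then $a_1\ge a_2\ge\dots\ge a_r$); (iv) $Q_r(x_1,\dots,x_r)=Q_{r+1}(x_1,\dots,x_r,0)$. Furthermore, $$PC(\mathbf{x}) = \frac{Q(\mathbf{x})}{\prod_{i=1}^\infty \left(1 - \prod_{j=1}^i x_j^{1+i-j}\right)},$$ where $Q(\mathbf{x})$ is a formal power series (in $x_1,x_2,x_3,\dots$) with the property that for each positive integer $\ell$, $Q(x_1,\dots,x_\ell,0,0,\dots)=Q_\ell(x_1,\dots,x_\ell)$; in other words, with the convention $Q_0=1$, $Q = 1+\sum_{i=1}^\infty (Q_i-Q_{i-1})$.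
   Context: $\mathbb{N}=\{0,1,2,\dots\}$ and $\mathbb{Z}_+=\{1,2,3,\dots\}$. A partition is a weakly decreasing sequence $\lambda=(\lambda_1,\lambda_2,\lambda_3,\dots)$ of non-negative integers, all but finitely many of which are zero; its parts are its nonzero entries. Its Ferrers diagram is $F(\lambda)=\{(i,j)\in\mathbb{N}^2 : i<\lambda_{j+1}\}$, and $I(\lambda)=\mathbb{N}^2\setminus F(\lambda)$, which is a monoid ideal of the additive monoid $\mathbb{N}^2$ (that is, $I(\lambda)+\mathbb{N}^2\subseteq I(\lambda)$). The integral closure of a monoid ideal $I\subseteq\mathbb{N}^2$ is $\bar I=\{\mathbf{a}\in \mathbb{N}^2 : \ell\mathbf{a}\in I \text{ for some } \ell\in\mathbb{Z}_+\}$ where, for this definition, the condition $\ell\mathbf{a}\in I$ is understood as $\ell\mathbf{a}\in \ell I:= I+\dots+I$ ($\ell$ summands), so that $\bar I$ equals $\mathrm{conv}_{\mathbb{Q}}(I)\cap\mathbb{N}^2$, with $\mathrm{conv}_{\mathbb{Q}}(I)$ the convex hull of $I$ in $\mathbb{Q}^2$; $I$ is integrally closed if $I=\bar I$. A partition $\lambda$ is called concave if $I(\lambda)$ is integrally closed. For a partition $\lambda$ put $\mathbf{x}^\lambda=x_1^{\lambda_1}x_2^{\lambda_2}\cdots$. Define the formal power series $$PC(\mathbf{x})=\sum_{\lambda\text{ concave}}\mathbf{x}^\lambda,\qquad PC_r(x_1,\dots,x_r)=PC(x_1,\dots,x_r,0,0,\dots)=\sum_{\lambda\text{ concave},\ \lambda_{r+1}=0}\mathbf{x}^\lambda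 .$$ *)

(* Defs.v *)
From HB Require Import structures.
From mathcomp Require Import all_boot all_order all_algebra.
From mathcomp Require Import finmap multiset.
From mathcomp Require Import boolp classical_sets.
From mathcomp Require Import mpoly.

Set Implicit Arguments.
Unset Strict Implicit.
Unset Printing Implicit Defensive.

Import GRing.Theory.

Local Open Scope ring_scope.
Local Open Scope mset_scope.

Section SubMultisets.
Variable K : choiceType.
Implicit Types (a b m : {mset K}) (s : seq K).

Definition msubs m : {fset {mset K}} :=
  foldr (fun x S => S `|` [fset x +` a | a in S])%fset [fset mset0]%fset m.

Lemma msetB1_sub x m a : a `<=` x +` m -> a `\ x `<=` m.
Proof.
move/msubsetP=> h; apply/msubsetP => y; have := h y.
by rewrite msetB1E mset1DE leq_subLR.
Qed.

Lemma sub_msetB1 x m a : a `<=` x +` m -> x \notin a -> a `<=` m.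
Proof.
move=> /msubsetP h xa; apply/msubsetP => y; have := h y; rewrite mset1DE.
by case: (eqVneq y x) => [->|//]; rewrite (mset_eq0P xa).
Qed.

Lemma in_msubs m a : (a \in msubs m) = (a `<=` m).
Proof.
rewrite /msubs -[in RHS](seq_mset_id m).
elim: {m}(enum_mset m) a => [|x s IHs] a /=.
  rewrite in_fset1 -(msubset0 a); congr (msubset a _).
  by apply/msetP => y; rewrite mset_seqE mset0E.
rewrite in_fsetU IHs mset_cons; apply/orP/idP => [[as_|]|axs].
- by apply/msubsetP => y; rewrite mset1DE (leq_trans (msubsetP as_ y)) ?leq_addl.
- case/imfsetP => b /= bs ->; apply/msubsetP => y; rewrite !mset1DE leq_add2l.
  by move: bs; rewrite IHs => /msubsetP.
- have [xa|xa] := boolP (x \in a); last by left; apply: sub_msetB1 axs xa.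
  right; apply/imfsetP; exists (a `\ x); last by rewrite msetB1K.
  by rewrite /= IHs msetB1_sub.
Qed.

End SubMultisets.

(* Formal power series over R in the commuting variables x_k, k in K: the      *)
(* multiset m stands for the monomial \prod_k x_k ^ (m k), and f m is the      *)
(* coefficient of that monomial in f.                                          *)
Record mps (K : choiceType) (R : Type) := Mps { mps_coef :> {mset K} -> R }.

Section SeriesRing.
Variables (K : choiceType) (R : comNzRingType).
Implicit Types (f g h : mps K R) (a b c m : {mset K}).

HB.instance Definition _ := gen_eqMixin (mps K R).
HB.instance Definition _ := gen_choiceMixin (mps K R).

Lemma mpsP f g : (forall m, f m = g m) -> f = g.
Proof. by case: f g => [f] [g] /= fg; congr Mps; apply/funext. Qed.

Definition mps0 : mps K R := Mps (fun=> 0).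
Definition mps_opp f := Mps (fun m => - f m).
Definition mps_add f g := Mps (fun m => f m + g m).
Definition mps1 : mps K R := Mps (fun m => (m == mset0)%:R).
Definition mps_mul f g := Mps (fun m => \sum_(a <- msubs m) f a * g (m `\` a)).

Fact mps_addA : associative mps_add.
Proof. by move=> f g h; apply: mpsP => m /=; rewrite addrA. Qed.

Fact mps_addC : commutative mps_add.
Proof. by move=> f g; apply: mpsP => m /=; rewrite addrC. Qed.

Fact mps_add0 : left_id mps0 mps_add.
Proof. by move=> f; apply: mpsP => m /=; rewrite add0r. Qed.

Fact mps_addN : left_inverse mps0 mps_opp mps_add.
Proof. by move=> f; apply: mpsP => m /=; rewrite addNr. Qed.

HB.instance Definition _ := GRing.isZmodule.Build (mps K R)
  mps_addA mps_addC mps_add0 mps_addN.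

Fact mps_mulC : commutative mps_mul.
Proof.
move=> f g; apply: mpsP => m /=.
rewrite (perm_big [seq m `\` a | a <- msubs m]) /=; last first.
  apply: uniq_perm; first exact: fset_uniq.
    rewrite map_inj_in_uniq ?fset_uniq // => a b; rewrite !in_msubs => am bm.
    by move/(congr1 (msetB m)); rewrite !msetBBK.
  move=> a; apply/idP/mapP => [|[b]]; rewrite in_msubs => am.
    by exists (m `\` a); rewrite ?msetBBK // in_msubs msubsetDl.
  by move=> ->; rewrite in_msubs msubsetDl.
rewrite big_map big_seq [RHS]big_seq; apply: eq_bigr => a.
by rewrite in_msubs => am; rewrite msetBBK // mulrC.
Qed.

Fact mps_mul1 : left_id mps1 mps_mul.
Proof.
move=> f; apply: mpsP => m /=.
rewrite (big_fsetD1 mset0) /= ?in_msubs ?msub0set //.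
rewrite eqxx mul1r msetB0 big_seq big1 ?addr0 // => a.
by rewrite !inE => /andP[/negPf-> _]; rewrite mul0r.
Qed.

Fact mps_mulDl : left_distributive mps_mul mps_add.
Proof.
move=> f g h; apply: mpsP => m /=; rewrite -big_split /=.
by apply: eq_bigr => a _; rewrite mulrDl.
Qed.

Fact mps_mulA : associative mps_mul.
Proof.
move=> f g h; apply: mpsP => m /=.
pose F a b := f b * g (a `\` b) * h (m `\` a).
transitivity (\sum_(a <- msubs m) \sum_(b <- msubs m | b `<=` a) F a b); last first.
  rewrite big_seq [RHS]big_seq; apply: eq_bigr => a; rewrite in_msubs => am.
  rewrite mulr_suml -big_filter; apply: perm_big; apply: uniq_perm.
  - by rewrite filter_uniq ?fset_uniq.
  - exact: fset_uniq.
  move=> b; rewrite mem_filter !in_msubs andbC andb_idl //.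
  by move=> ba; apply: msubset_trans am.
rewrite (exchange_big_dep xpredT) //=.
rewrite big_seq [RHS]big_seq; apply: eq_bigr => b; rewrite in_msubs => bm.
rewrite mulr_sumr -[RHS]big_filter.
rewrite [RHS](perm_big [seq b `+` c | c <- msubs (m `\` b)]) /=.
  rewrite big_map; apply: eq_bigr => c _.
  by rewrite /F msetDKB msetBDA mulrA.
apply: uniq_perm.
- by rewrite filter_uniq ?fset_uniq.
- rewrite map_inj_uniq ?fset_uniq // => c d /(congr1 (msetB^~ b)).
  by rewrite !msetDKB.
move=> a; rewrite mem_filter in_msubs; apply/andP/mapP => [[ba am]|[c]].
  exists (a `\` b); last by rewrite msetBDKC.
  by rewrite in_msubs msetSB.
rewrite in_msubs => cmb ->; split; first by apply/msubsetP => x; rewrite msetE2 leq_addr.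
by rewrite -(msetBDKC bm) msetDS.
Qed.

Fact mps1_neq0 : mps1 != 0.
Proof.
apply/eqP => /(congr1 (fun f : mps K R => f mset0)) /eqP /=.
by rewrite eqxx oner_eq0.
Qed.

HB.instance Definition _ := GRing.Zmodule_isComNzRing.Build (mps K R)
  mps_mulA mps_mulC mps_mul1 mps_mulDl mps1_neq0.

Lemma mps_coef0M f g : (f * g) mset0 = f mset0 * g mset0.
Proof.
change (\sum_(a <- msubs mset0) f a * g (mset0 `\` a) = f mset0 * g mset0).
rewrite (_ : msubs mset0 = [fset mset0]%fset) ?big_seq_fset1 ?msetB0 //.
by apply/fsetP => a; rewrite in_msubs msubset0 inE.
Qed.

Lemma mps_coef0B f g : (f - g) mset0 = f mset0 - g mset0.
Proof. by []. Qed.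

Lemma mps_coef0_1 : (1 : mps K R) mset0 = 1.
Proof. by rewrite [LHS](_ : _ = (mset0 == mset0 :> {mset K})%:R) // eqxx. Qed.

Definition mpsX (k : K) : mps K R := Mps (fun m => (m == [mset k])%:R).

Lemma mps_coef0X k : mpsX k mset0 = 0.
Proof. by rewrite /= eq_sym -size_mset_eq0 enum_msetn. Qed.

End SeriesRing.

Section SeriesUnitRing.
Variables (K : choiceType) (R : comUnitRingType).
Implicit Types (f g : mps K R) (a m : {mset K}).

Definition mps_unit : {pred mps K R} :=
  fun f => f mset0 \is a GRing.unit.

Fixpoint mps_inv_rec f (n : nat) m : R :=
  if n is n'.+1 then
    (f mset0)^-1 * ((m == mset0)%:R
      - \sum_(a <- msubs m | a != mset0) f a * mps_inv_rec f n' (m `\` a))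
  else 0.

(* The inverse of a non-unit is itself, as required by unitRingType.           *)
Definition mps_inv f :=
  if mps_unit f then Mps (fun m => mps_inv_rec f (size m).+1 m) else f.

Lemma size_msetB a m : a `<=` m -> size m = (size a + size (m `\` a))%N.
Proof.
move=> am; rewrite -[in LHS](msetBDKC am) -size_cat; apply/perm_size/allP=> x _ /=.
by rewrite count_cat !count_mem_mset msetE2.
Qed.

Lemma mps_inv_rec_eq f n n' m : (size m < n)%N -> (size m < n')%N ->
  mps_inv_rec f n m = mps_inv_rec f n' m.
Proof.
elim: n n' m => // n IHn [//|n'] m lt_mn lt_mn' /=; congr (_ * (_ - _)).
rewrite big_seq_cond [RHS]big_seq_cond; apply: eq_bigr => a.
rewrite in_msubs => /andP[am a0]; congr (_ * _).
have lt_am : (size (m `\` a) < size m)%N.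
  by rewrite (size_msetB am) -[X in (X < _)%N]add0n ltn_add2r lt0n size_mset_eq0.
by apply: IHn; apply: leq_trans lt_am _.
Qed.

Fact mps_mulVr : {in mps_unit, left_inverse 1 mps_inv *%R}.
Proof.
move=> f fu; rewrite mulrC; apply: mpsP => m.
rewrite /mps_inv ifT //= (big_fsetD1 mset0) ?in_msubs ?msub0set //=.
rewrite msetB0 mulVKr //.
rewrite [X in _ - X](_ : _ =
  \sum_(a <- (msubs m `\ mset0)%fset) f a * mps_inv_rec f (size (m `\` a)).+1 (m `\` a)).
  by rewrite subrK.
rewrite -big_filter; transitivity (\sum_(a <- (msubs m `\ mset0)%fset)
    f a * mps_inv_rec f (size m) (m `\` a)).
  apply: perm_big; apply: uniq_perm; rewrite ?filter_uniq ?fset_uniq // => a.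
  by rewrite mem_filter !inE.
rewrite big_seq [RHS]big_seq; apply: eq_bigr => a.
rewrite !inE in_msubs => /andP[a0 am]; congr (_ * _); apply: mps_inv_rec_eq => //.
by rewrite (size_msetB am) -[X in (X < _)%N]add0n ltn_add2r lt0n size_mset_eq0.
Qed.

Fact mps_unitPl f g : g * f = 1 -> mps_unit f.
Proof.
move/(congr1 (fun h : mps K R => h mset0)); rewrite mps_coef0M /= eqxx => gf1.
by apply/unitrP; exists (g mset0); rewrite [f _ * _]mulrC.
Qed.

Fact mps_inv_out : {in [predC mps_unit], mps_inv =1 id}.
Proof. by move=> f; rewrite inE /mps_inv => /negPf fNu; rewrite ifF. Qed.

HB.instance Definition _ := GRing.ComNzRing_hasMulInverse.Build (mps K R)
  mps_mulVr mps_unitPl mps_inv_out.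

Lemma mps_unitE f : (f \is a GRing.unit) = (f mset0 \is a GRing.unit).
Proof. by []. Qed.

End SeriesUnitRing.

(* Coefficientwise convergence, i.e. convergence of series for the product     *)
(* topology on coefficient families over the discrete coefficient ring.        *)
Definition mps_cvg (K : choiceType) (R : Type) (u : nat -> mps K R) (f : mps K R) :=
  forall m, exists N, forall n, (N <= n)%N -> u n m = f m.

(* Variables and parts are numbered from 0: 'x_k stands for x_(k+1), and l k   *)
(* for lambda_(k+1). A partition, being a finitely supported sequence, is      *)
(* identified with the exponent vector of its monomial x^lambda.               *)
Definition series := mps nat int.

Notation "''x_' i" := (mpsX (K := nat) int i)
  (at level 8, i at level 2, format "''x_' i") : ring_scope.

(* The substitution x_(r+1) = x_(r+2) = ... = 0 kills exactly the monomials    *)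
(* that involve one of these variables.                                        *)
Definition mps_trunc (r : nat) (f : series) : series :=
  Mps (fun m => if all (fun k => k < r)%N m then f m else 0).

Definition mps_of_mpoly (r : nat) (p : {mpoly int[r]}) : series :=
  mmap intr (fun i : 'I_r => 'x_i) p.

Definition is_partition (l : {mset nat}) : Prop :=
  forall i j, (i <= j)%N -> (l j <= l i)%N.

Local Open Scope classical_set_scope.

Definition ferrers (l : {mset nat}) : set (nat * nat) :=
  [set p | (p.1 < l p.2)%N].

Definition partition_ideal (l : {mset nat}) : set (nat * nat) := ~` ferrers l.

Definition nfold_sum (n : nat) (I : set (nat * nat)) : set (nat * nat) :=
  [set s | exists2 t : 'I_n -> nat * nat, (forall k, I (t k)) & s = \sum_(k < n) t k].

Definition integral_closure (I : set (nat * nat)) : set (nat * nat) :=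
  [set a | exists2 n, (0 < n)%N & nfold_sum n I (a *+ n)].

Definition integrally_closed (I : set (nat * nat)) : Prop :=
  I = integral_closure I.

Definition concave (l : {mset nat}) : Prop :=
  is_partition l /\ integrally_closed (partition_ideal l).

Definition PC : series := Mps (fun l => if `[< concave l >] then 1 else 0).

Definition PC_ (r : nat) : series := mps_trunc r PC.

(* Shifting both i and j by one leaves the exponent 1 + i - j unchanged.       *)
Definition denom (r : nat) : series :=
  \prod_(i < r) (1 - \prod_(j < i.+1) 'x_j ^+ (i.+1 - j)).

Lemma denom_coef0 r : denom r mset0 = 1.
Proof.
rewrite /denom; elim/big_ind: _ => [|f g f1 g1|i _]; first exact: mps_coef0_1.
  by rewrite mps_coef0M f1 g1 mulr1.
by rewrite mps_coef0B mps_coef0_1 big_ord_recr subSnn mps_coef0M mps_coef0X mulr0 subr0.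
Qed.

Lemma denom_unit r : denom r \is a GRing.unit.
Proof. by rewrite mps_unitE denom_coef0. Qed.

Lemma denom_lim_unit (f : series) : mps_cvg denom f -> f \is a GRing.unit.
Proof. by case/(_ mset0) => N /(_ N (leqnn N)) eqf; rewrite mps_unitE -eqf denom_coef0. Qed.

(* Main.v *)
From HB Require Import structures.
Require Import Defs.
From mathcomp Require Import all_boot all_order all_algebra.
From mathcomp Require Import finmap multiset mpoly.
From mathcomp Require Import boolp classical_sets.
From mathcomp Require Import ring zify.

(** Concave partitions are the lattice points of a slightly fattened cone.
Let [v_k = (k+1, k, ..., 1)] (the partition [stair k] below) and let [c_k] be
the second difference [m_k - 2 m_(k+1) + m_(k+2)] ([curv m k]). An exponent
vector [m] in the variables [x_0 .. x_(r-1)] is [\sum_k c_k v_k], so the [c_k]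
are coordinates on the lattice Z^r, and the denominator is
[\prod_k (1 - x^(v_k))].

A finitely supported [m] is concave iff it lies less than one unit above each
of its chords ([concaveP]). In terms of the [c_k] this has three consequences:
- adding some [v_k] preserves concavity ([concaveD_stair]);
- a concave [m] has all [c_k >= -1], and if all [c_k >= 0] then [m] is concave
  ([concave_curv], [concave_curv_ge0]);
- once [c_i] is large in terms of [r], concavity no longer depends on its exact
  value, so that [v_i] may be subtracted ([concaveB_stair]).

Sort the concave [m] by the first index [k] with [c_k = -1]. Those without such
an index are exactly the nonnegative combinations of the [v_k], with generating
function [1 / \prod_k (1 - x^(v_k))] ([convex_series]). For those with first
index [k], the value of [c_k] is fixed, and multiplication by the factors
[1 - x^(v_i)], [i != k], cancels all terms with [c_i] large; only finitely many
terms are left, and they form a polynomial [p_k] ([first_dent_mpoly]). Hence the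
numerator is [Q_r = 1 + \sum_k (1 - x^(v_k)) p_k], an integer polynomial whose
value at [(1, ..., 1)] is [1] ([PC_numerator]).

The monomials of [Q_r] are sums of a concave partition and of some [v_k], hence
partitions ([numerator_support]). The compatibilities between the [Q_r], and the
limit in infinitely many variables, hold because setting
[x_r = x_(r+1) = ... = 0] is a ring morphism that sends the [n]-th denominator
to the [r]-th one for [r <= n] ([trunc_denom]), while polynomials inject into
power series ([mps_of_mpoly_inj]). *)

Set Implicit Arguments.
Unset Strict Implicit.
Unset Printing Implicit Defensive.

Import Order.TTheory GRing.Theory Num.Theory.
Local Open Scope ring_scope.
Local Open Scope mset_scope.

(** * Staircases and second differences *)

Definition mset_of (r : nat) (e : nat -> nat) : {mset nat} :=
  seq_mset (flatten [seq nseq (e i) i | i <- iota 0 r]).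

Lemma mset_ofE r e i : mset_of r e i = if (i < r)%N then e i else 0%N.
Proof.
rewrite mset_seqE count_flatten -map_comp sumnE big_map.
rewrite (eq_bigr (fun k => if k == i then e i else 0%N)) => [|k _]; last first.
  by rewrite /= count_nseq /=; case: eqP => [->|_]; rewrite ?mul1n ?mul0n.
rewrite -big_mkcond /= big_const_seq iter_addn_0 -[count _ _]/(count_mem i _).
by rewrite count_uniq_mem ?iota_uniq // mem_iota /= add0n; case: ifP; rewrite ?muln1 ?muln0.
Qed.

Definition vars_below (r : nat) (m : {mset nat}) : bool := all (fun k => k < r)%N m.

Lemma vars_belowP r (m : {mset nat}) :
  reflect (forall i, (r <= i)%N -> m i = 0%N) (vars_below r m).
Proof.
apply: (iffP allP) => [h i ri|h i im].
  by apply/eqP; rewrite mset_eq0; apply/negP => /h; rewrite ltnNge ri.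
by rewrite ltnNge; apply/negP => /h /eqP; rewrite mset_eq0 im.
Qed.

Lemma vars_belowD r (a b : {mset nat}) : vars_below r (a `+` b) = vars_below r a && vars_below r b.
Proof.
apply/vars_belowP/andP => [h|[/vars_belowP ha /vars_belowP hb] i ri].
  by split; apply/vars_belowP => i /h; rewrite msetE2; lia.
by rewrite msetE2 ha ?hb.
Qed.

Definition stair (k : nat) : {mset nat} := mset_of k.+1 (fun i => k.+1 - i)%N.

Lemma stairE k i : stair k i = (k.+1 - i)%N.
Proof. by rewrite mset_ofE; case: ltnP => // ?; lia. Qed.

Lemma stair_below r k : (k < r)%N -> vars_below r (stair k).
Proof. by move=> kr; apply/vars_belowP => i ri; rewrite stairE; lia. Qed.

Definition curv (m : {mset nat}) (i : nat) : int :=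
  (m i)%:Z - 2 * (m i.+1)%:Z + (m i.+2)%:Z.

Lemma curvD (a b : {mset nat}) i : curv (a `+` b) i = curv a i + curv b i.
Proof. by rewrite /curv !msetE2; lia. Qed.

Lemma curv_stair k i : curv (stair k) i = (i == k)%:Z.
Proof. by rewrite /curv !stairE; lia. Qed.

Lemma curvB_stair k (m : {mset nat}) i : stair k `<=` m ->
  curv m i = (i == k)%:Z + curv (m `\` stair k) i.
Proof. by move=> km; rewrite -[in LHS](msetBDKC km) curvD curv_stair. Qed.

(** The staircases form a basis of the exponent vectors, with the second
differences as coordinates: both sides vanish from [r] on and have the same
second differences. *)
Lemma curv_expansion r (m : {mset nat}) i : vars_below r m ->
  (m i)%:Z = \sum_(k < r) curv m k * (stair k i)%:Z.
Proof.
move/vars_belowP=> mr.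
have [ri|ir] := leqP r i.
  rewrite mr // big1 // => k _.
  by rewrite stairE (_ : (k.+1 - i)%N = 0%N) ?mulr0 //; have := ltn_ord k; lia.
pose S j := \sum_(k < r) curv m k * (stair k j)%:Z.
have SE j : (j < r)%N -> S j - 2 * S j.+1 + S j.+2 = curv m j.
  move=> jr; rewrite /S mulr_sumr -sumrB -big_split /=.
  rewrite (eq_bigr (fun k : 'I_r => curv m k * (j == k)%:Z)) => [|k _]; last first.
    by rewrite -curv_stair /curv; ring.
  rewrite (bigD1 (Ordinal jr)) //= eqxx mulr1 big1 ?addr0 // => k.
  by rewrite -val_eqE /= eq_sym => /negPf->; rewrite mulr0.
have S0 j : (r <= j)%N -> S j = 0.
  move=> rj; rewrite /S big1 // => k _.
  by rewrite stairE (_ : (k.+1 - j)%N = 0%N) ?mulr0 //; have := ltn_ord k; lia.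
suff: forall d j, (r <= j + d)%N -> (m j)%:Z = S j /\ (m j.+1)%:Z = S j.+1.
  by case/(_ r i); rewrite ?leq_addl.
elim=> [|d IH] j rj; first by rewrite !S0 ?mr //; lia.
have [m1 m2] := IH j.+1 ltac:(lia).
have [rj'|jr] := leqP r j; first by rewrite !S0 ?mr //; lia.
by split=> //; have := SE j jr; rewrite -m1 -m2 /curv; lia.
Qed.

(** * Chords *)

(** This is [p + q] times the height of the chord from [a] to [a + p + q] above
the point of [m] at [a + p]; clearing the denominator keeps it an integer. *)
Definition gap (m : {mset nat}) (a p q : nat) : int :=
  q%:Z * (m a)%:Z + p%:Z * (m (a + p + q)%N)%:Z - (p + q)%:Z * (m (a + p)%N)%:Z.

Lemma gapD (m n : {mset nat}) a p q : gap (m `+` n) a p q = gap m a p q + gap n a p q.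
Proof. by rewrite /gap !msetE2 !PoszD; ring. Qed.

Lemma gap_expansion r (m : {mset nat}) a p q : vars_below r m ->
  gap m a p q = \sum_(k < r) curv m k * gap (stair k) a p q.
Proof.
move=> mr; rewrite /gap !(curv_expansion _ mr) !mulr_sumr -big_split -sumrB /=.
by apply: eq_bigr => k _; ring.
Qed.

(** As a function of its index, [stair k] is linear on both sides of a kink at
[k + 1]. For fixed chord the gap is therefore linear in the position of the kink on each
side of [a + p], and the truncated subtractions give [0] when the chord avoids
the kink. *)
Lemma gap_stairE k a p q : gap (stair k) a p q =
  if (k < a + p)%N then q%:Z * (k.+1 - a)%N%:Z else p%:Z * (a + p + q - k.+1)%N%:Z.
Proof.
rewrite /gap !stairE; case: ltnP => [kap|apk].
  have -> : (k.+1 - (a + p))%N = 0%N by lia.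
  have -> : (k.+1 - (a + p + q))%N = 0%N by lia.
  by ring.
have -> : (k.+1 - a)%N = k.+1%:Z - a%:Z :> int by lia.
have -> : (k.+1 - (a + p))%N = k.+1%:Z - a%:Z - p%:Z :> int by lia.
have [kb|bk] := leqP k.+1 (a + p + q).
  have -> : (k.+1 - (a + p + q))%N = 0%N by lia.
  have -> : (a + p + q - k.+1)%N = a%:Z + p%:Z + q%:Z - k.+1%:Z :> int by lia.
  by rewrite PoszD; ring.
have -> : (k.+1 - (a + p + q))%N = k.+1%:Z - a%:Z - p%:Z - q%:Z :> int by lia.
have -> : (a + p + q - k.+1)%N = 0%N by lia.
by rewrite PoszD; ring.
Qed.

Lemma gap_stair_ge0 k a p q : 0 <= gap (stair k) a p q.
Proof. by rewrite gap_stairE; case: ifP => _; apply: mulr_ge0. Qed.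

Lemma gap_stair_eq0 k a p q : ~~ (a < k.+1 < a + p + q)%N -> gap (stair k) a p q = 0.
Proof.
rewrite gap_stairE => h; case: ltnP => h'; apply/eqP; rewrite mulf_eq0; apply/orP.
  by have [?|?] := leqP k.+1 a; [right | left]; lia.
by right; lia.
Qed.

(** Among the first [r] staircases, none has a much larger gap than one whose
kink is under the chord.
The bound is uniform in the length of the chord, which may exceed [r]; this is
what makes the threshold [curv_bound] below depend on [r] only. *)
Lemma gap_stair_le r i k a p q : (i < r)%N -> (k < r)%N ->
  (a < i.+1 < a + p + q)%N -> gap (stair k) a p q <= r.+1%:Z * gap (stair i) a p q.
Proof.
move=> ir kr /andP[ai ib].
have [kq kpq] : gap (stair k) a p q <= q%:Z * r%:Z /\
    gap (stair k) a p q <= p%:Z * (p + q + a)%N%:Z.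
  rewrite gap_stairE; case: ltnP => h; rewrite -!PoszM !lez_nat; split.
  - by rewrite leq_mul2l; lia.
  - have : (k.+1 - a <= p)%N by lia.
    move=> h'; apply: (@leq_trans (q * p)); first by rewrite leq_mul2l h' orbT.
    by rewrite mulnC leq_mul2l; lia.
  - apply: (@leq_trans (p * q)); first by rewrite leq_mul2l; lia.
    by rewrite mulnC leq_mul2l; lia.
  - by rewrite leq_mul2l; lia.
rewrite [gap (stair i) _ _ _]gap_stairE; case: ltnP => h.
  apply: le_trans kq _; rewrite -!PoszM lez_nat mulnCA leq_mul2l; apply/orP; right.
  by apply: (@leq_trans (r.+1 * 1)); [lia | rewrite leq_mul2l; lia].
apply: le_trans kpq _; rewrite -!PoszM lez_nat mulnCA leq_mul2l; apply/orP; right.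
set d := (a + p + q - i.+1)%N.
have : (r * 1 <= r * d)%N by rewrite leq_mul2l /d; lia.
by rewrite mulSn /d; lia.
Qed.

(** * Concave partitions are nearly convex sequences *)

(** The sequence stays less than one unit above its chords. *)
Definition nearly_convex (m : {mset nat}) : Prop :=
  forall a p q, (0 < p)%N -> (0 < q)%N -> - (p + q)%N%:Z < gap m a p q.

Lemma fst_sum n (t : 'I_n -> nat * nat) : (\sum_(k < n) t k).1 = (\sum_(k < n) (t k).1)%N.
Proof. exact: big_morph. Qed.

Lemma snd_sum n (t : 'I_n -> nat * nat) : (\sum_(k < n) t k).2 = (\sum_(k < n) (t k).2)%N.
Proof. exact: big_morph. Qed.

Lemma pair_natmul (x : nat * nat) n : x *+ n = ((x.1 * n)%N, (x.2 * n)%N).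
Proof.
elim: n => [|n IH]; first by rewrite !muln0.
by rewrite mulrS IH !mulnS.
Qed.

Lemma partition_idealE l x y : partition_ideal l (x, y) <-> (l y <= x)%N.
Proof. by rewrite leqNgt; split=> /negP. Qed.

(** First coordinates are thought of as heights over the second ones. A violated
chord inequality says that [q] copies of the point at [a] and [p]
copies of the point at [a + p + q] have an average on or below the lattice point
just under the profile at [a + p]. The ideal is closed under moving to larger
first coordinates, so adding the slack [s] to one of the points makes that
lattice point the exact average, and it belongs to the closure but not to the
ideal. *)
Lemma concave_nearly_convex l : concave l -> nearly_convex l.
Proof.
case=> _ cl a p q p0 q0; rewrite ltNge; apply/negP => h.
have lj0 : (0 < l (a + p))%N by move: h; rewrite /gap; case: (l (a + p)%N) => //; nia.
have le_s : (q * l a + p * l (a + p + q) <= (l (a + p)).-1 * (q + p))%N.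
  have arith (x y z : nat) : q%:Z * x%:Z + p%:Z * y%:Z - (p + q)%N%:Z * z%:Z <= - (p + q)%N%:Z ->
      (0 < z)%N -> (q * x + p * y <= z.-1 * (q + p))%N.
    case: z => // z.
    rewrite -[z.+1]addn1 !PoszD => h1 _; rewrite -lez_nat addn1 !PoszD !PoszM PoszD /=.
    rewrite -subr_ge0; move: h1; rewrite -subr_ge0 => /le_trans; apply.
    by rewrite le_eqVlt; apply/orP; left; apply/eqP; ring.
  exact: arith h lj0.
suff : partition_ideal l ((l (a + p)).-1, (a + p)%N).
  by rewrite partition_idealE leqNgt ltn_predL lj0.
rewrite cl; exists (q + p)%N; first by lia.
pose s := ((l (a + p)).-1 * (q + p) - (q * l a + p * l (a + p + q)))%N.
exists (fun k => match split k with
  | inl i => ((l a + (i == 0 :> nat) * s)%N, a) | inr _ => (l (a + p + q)%N, (a + p + q)%N) end).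
  by move=> k; case: split => i; rewrite partition_idealE ?leq_addr.
rewrite pair_natmul [RHS]surjective_pairing fst_sum snd_sum !big_split_ord /=.
under eq_bigr => i _ do rewrite (unsplitK (inl i)).
under [X in (_, (X + _)%N)]eq_bigr => i _ do rewrite (unsplitK (inl i)).
under [X in ((_ + X)%N, _)]eq_bigr => i _ do rewrite (unsplitK (inr i)).
under [X in (_, (_ + X)%N)]eq_bigr => i _ do rewrite (unsplitK (inr i)).
rewrite /= big_split /= !sum_nat_const !card_ord; congr pair; last by lia.
rewrite (bigD1 (Ordinal q0)) //= big1 => [|i]; first by rewrite mul1n addn0 addnAC /s subnKC.
by rewrite -val_eqE /= => /negPf->.
Qed.

Lemma sumr_gt0_at (I : finType) (P : pred I) (F : I -> int) i0 :
  P i0 -> 0 < F i0 -> (forall i, P i -> 0 <= F i) -> 0 < \sum_(i | P i) F i.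
Proof.
move=> Pi0 Fi0 F0; rewrite (bigD1 i0) //=; apply: ltr_pwDl => //.
by apply: sumr_ge0 => i /andP[/F0].
Qed.

(** Suppose that points of the ideal average to [(x, j)] with [x < l j]. For such
a point with second coordinate [y], let [d = y - j] and let [u] be the height of
the profile at [y] above the level [l j - 1]. The [d] sum to [0], and the [u] to
at most [0] because the points are not below the profile. But the chord between
two profile points on either side of [j] passes strictly above that level
([cross]), and adding up these inequalities over all such pairs shows that the
[u] sum to a positive number. *)
Lemma nearly_convex_concave l : is_partition l -> nearly_convex l -> concave l.
Proof.
move=> lp lc; split=> //; apply/seteqP; split=> [x Ix|[x j]].
  exists 1%N => //; exists (fun=> x) => //.
  by rewrite big_ord1.
case=> n n0 [t tI]; rewrite pair_natmul /= => tE.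
have := congr1 fst tE; have := congr1 snd tE; rewrite fst_sum snd_sum /= => tj tx.
rewrite partition_idealE leqNgt; apply/negP => xj.
pose u k : int := (l (t k).2)%:Z - (l j)%:Z + 1.
pose d k : int := (t k).2%:Z - j%:Z.
have sum_d : \sum_k d k = 0.
  by rewrite sumrB sumr_const card_ord -(big_morph Posz PoszD (erefl _)) -tj; lia.
have sum_u : \sum_k u k <= 0.
  have : \sum_k u k <= \sum_(k < n) ((t k).1%:Z - x%:Z).
    apply: ler_sum => k _; have := tI k.
    rewrite [t k]surjective_pairing partition_idealE /u /= => h.
    by move: xj => /= xj'; lia.
  rewrite [X in _ <= X]sumrB sumr_const card_ord -(big_morph Posz PoszD (erefl _)) -tx; lia.
have cross k1 k2 : d k1 < 0 -> 0 < d k2 -> 0 < d k2 * u k1 - d k1 * u k2.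
  rewrite /d => d1 d2.
  have := lc (t k1).2 (j - (t k1).2)%N ((t k2).2 - j)%N ltac:(lia) ltac:(lia).
  rewrite /gap /u.
  have -> : ((t k1).2 + (j - (t k1).2))%N = j by lia.
  have -> : (j + ((t k2).2 - j))%N = (t k2).2 by lia.
  rewrite PoszD.
  have -> : (j - (t k1).2)%N = j%:Z - (t k1).2%:Z :> int by lia.
  have -> : ((t k2).2 - j)%N = (t k2).2%:Z - j%:Z :> int by lia.
  rewrite -subr_gt0 => /lt_le_trans; apply.
  by rewrite le_eqVlt; apply/orP; left; apply/eqP; ring.
pose A k := d k < 0; pose B k := 0 < d k.
have [/existsP[k2 Bk2]|] := boolP [exists k, B k]; last first.
  rewrite negb_exists => /forallP dB.
  have d0 k : d k = 0.
    apply/eqP; rewrite -oppr_eq0; move: k; apply/forallP.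
    have : \sum_k - d k = 0 by rewrite sumrN sum_d oppr0.
    move/psumr_eq0P => h; apply/forallP => k; apply/eqP; apply: h => // i _.
    by have := dB i; rewrite /B -leNgt oppr_ge0.
  move: sum_u; rewrite (eq_bigr (fun=> 1)) => [|k _].
    by rewrite sumr_const card_ord; lia.
  by have := d0 k; rewrite /u /d => dk; rewrite (_ : (t k).2 = j); lia.
(* Points over [j] itself have [u > 0] and only help. *)
have sumAB (F : 'I_n -> int) :
    \sum_k F k = \sum_(k | A k) F k + (\sum_(k | B k) F k + \sum_(k | d k == 0) F k).
  rewrite (bigID A) /=; congr (_ + _); rewrite (bigID B) /=.
  congr (_ + _); apply: eq_bigl => k; rewrite /A /B.
    by case: ltgtP.
  by case: ltgtP.
have [k1 Ak1] : exists k, A k.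
  have [/existsP//|] := boolP [exists k, A k]; rewrite negb_exists => /forallP dA.
  have : 0 < \sum_k d k.
    apply: (sumr_gt0_at (i0 := k2)) => // k _; by have := dA k; rewrite -leNgt.
  by rewrite sum_d.
have D0 : 0 < \sum_(k | B k) d k by apply: (sumr_gt0_at (i0 := k2)) => // k; apply: ltW.
have DA : \sum_(k | A k) d k = - \sum_(k | B k) d k.
  move: sum_d; rewrite sumAB [X in _ + (_ + X)]big1 => [|k /eqP //].
  by lia.
have : 0 < \sum_(i | A i) \sum_(k | B k) (d k * u i - d i * u k).
  apply: (sumr_gt0_at (i0 := k1)) => // [|i Ai]; last by apply: sumr_ge0 => k Bk; exact/ltW/cross.
  by apply: (sumr_gt0_at (i0 := k2)) => // [|k Bk]; [|apply/ltW]; exact: cross.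
under eq_bigr => i _ do rewrite sumrB -mulr_suml -mulr_sumr.
rewrite sumrB -mulr_sumr -mulr_suml DA mulNr opprK -mulrDr pmulr_rgt0 // => U0.
move: sum_u; rewrite sumAB leNgt addrA => /negP; apply; apply: ltr_pwDl => //.
by apply: sumr_ge0 => k; rewrite /u /d subr_eq0 => /eqP[->]; lia.
Qed.

Lemma exists_vars_below (m : {mset nat}) : exists r, vars_below r m.
Proof.
exists (\max_(i <- m) i).+1; apply/allP => i im /=.
by rewrite ltnS; apply: leq_bigmax_seq.
Qed.

(** A finitely supported sequence that increases somewhere has a point at least one
unit above the chord from a smaller earlier value to a far end, where the
sequence is zero. *)
Lemma nearly_convex_partition (m : {mset nat}) : nearly_convex m -> is_partition m.
Proof.
move=> mc i j ij; have [r /vars_belowP mr] := exists_vars_below m.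
rewrite leqNgt; apply/negP => lt_ij.
have ij' : (0 < j - i)%N.
  by rewrite subn_gt0 ltn_neqAle ij andbT; apply: contraTneq lt_ij => ->; rewrite ltnn.
have := mc i (j - i)%N r.+1 ij' isT; rewrite /gap (subnKC ij) (mr (j + r.+1)%N); last by lia.
rewrite mulr0 addr0 ltNge => /negP; apply.
have arith (x y p q : int) : 0 <= x -> 0 <= p -> 0 <= q -> x + 1 <= y ->
    q * x - (p + q) * y <= - (p + q).
  move=> x0 p0 q0 xy; have pq0 : 0 <= p + q by apply: addr_ge0.
  rewrite -subr_ge0 (_ : _ - _ = (p + q) * y - (p + q) * (x + 1) + p * x); last by ring.
  by rewrite addr_ge0 ?mulr_ge0 // subr_ge0 ler_wpM2l.
by rewrite PoszD; apply: arith => //; rewrite -PoszD addn1 lez_nat.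
Qed.

Lemma concaveP (l : {mset nat}) : concave l <-> nearly_convex l.
Proof.
split=> [|lc]; first exact: concave_nearly_convex.
exact: nearly_convex_concave (nearly_convex_partition lc) lc.
Qed.

(** * Adding and subtracting staircases *)

Lemma concaveD_stair k (m : {mset nat}) : concave m -> concave (stair k `+` m).
Proof.
rewrite !concaveP => mc a p q p0 q0; rewrite gapD.
by apply: lt_le_trans (mc a p q p0 q0) _; rewrite lerDr gap_stair_ge0.
Qed.

Lemma concave_curv (m : {mset nat}) i : concave m -> -1 <= curv m i.
Proof.
by move=> /concaveP/(_ i 1 1 isT isT)%N; rewrite /gap /curv !addn1; lia.
Qed.

Lemma concave_curv_ge0 r (m : {mset nat}) :
  vars_below r m -> (forall i, (i < r)%N -> 0 <= curv m i) -> concave m.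
Proof.
move=> mr m0; apply/concaveP => a p q p0 q0; rewrite (gap_expansion _ _ _ mr).
apply: (@lt_le_trans _ _ 0); first by lia.
by apply: sumr_ge0 => k _; rewrite mulr_ge0 ?gap_stair_ge0 // m0.
Qed.

(** With [w i] comparable to the largest weight, a single large coefficient
[c i] outweighs all the coefficients that are only bounded below by [-1]. *)
Lemma sum_dominated (r : nat) (i : 'I_r) (c w : 'I_r -> int) :
    (forall k, -1 <= c k) -> (forall k, 0 <= w k <= r.+1%:Z * w i) ->
  (r * r.+1)%N%:Z <= c i -> 0 <= \sum_k c k * w k.
Proof.
move=> c1 wi ci.
have -> : \sum_k c k * w k = \sum_k (c k + 1) * w k - \sum_k w k.
  by rewrite -sumrB; apply: eq_bigr => k _; ring.
have wr : \sum_k w k <= \sum_(k < r) r.+1%:Z * w i.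
  by apply: ler_sum => k _; case/andP: (wi k).
rewrite subr_ge0; apply: le_trans wr _.
rewrite sumr_const card_ord (bigD1 i) //=.
apply: (@le_trans _ _ ((c i + 1) * w i)).
  rewrite -mulr_natl mulrA; apply: ler_wpM2r; first by case/andP: (wi i).
  by rewrite natz -PoszM; lia.
rewrite lerDl; apply: sumr_ge0 => k _; apply: mulr_ge0; last by case/andP: (wi k).
by have := c1 k; lia.
Qed.

(** The threshold of [sum_dominated], plus one for the staircase that is
subtracted. *)
Definition curv_bound (r : nat) : int := (r * r.+1).+1%:Z.

(** After the subtraction the [i]-th coordinate still dominates all others, both
in the entries of the sequence and in the gaps of the chords over the kink of
[stair i]; the other chords do not see the subtraction. Both facts are
instances of [sum_dominated], applied to the coordinates [c] of the difference
before it is known to be a multiset. *)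
Lemma concaveB_stair r i (m : {mset nat}) :
    vars_below r m -> concave m -> (i < r)%N -> curv_bound r <= curv m i ->
  stair i `<=` m /\ concave (m `\` stair i).
Proof.
move=> mr mc ir ci; pose c (k : 'I_r) := curv m k - (k == i :> nat)%:Z.
have ge0 w : (forall k : 'I_r, 0 <= w k <= r.+1%:Z * w (Ordinal ir)) -> 0 <= \sum_k c k * w k.
  move=> wi; apply: (sum_dominated (i := Ordinal ir)) => // [k|].
    rewrite /c; case: eqP => [->|_]; last by rewrite subr0 concave_curv.
    by move: ci; rewrite /curv_bound; lia.
  by move: ci; rewrite /c /= eqxx /curv_bound; lia.
have sum_c w : \sum_k c k * w k = \sum_(k < r) curv m k * w k - w (Ordinal ir).
  under eq_bigr => k _ do rewrite mulrBl.
  rewrite sumrB [X in _ - X](bigD1 (Ordinal ir)) //= eqxx mul1r.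
  rewrite [X in _ - (_ + X)]big1 ?addr0 // => k.
  by rewrite -val_eqE /= => /negPf->; rewrite mul0r.
have sm : stair i `<=` m.
  apply/msubsetP => l; rewrite -lez_nat (curv_expansion _ mr) -subr_ge0.
  rewrite -(sum_c (fun k : 'I_r => (stair k l)%:Z)).
  have [il|li] := leqP i.+1 l.
    rewrite sum_c /= -(curv_expansion _ mr) [stair i l]stairE.
    by rewrite (_ : (i.+1 - l)%N = 0%N) ?subr0 //; lia.
  apply: ge0 => k; rewrite /= !stairE -PoszM !lez_nat /=.
  apply: (@leq_trans (r.+1 * 1)); last by rewrite leq_mul2l; lia.
  by have := ltn_ord k; lia.
split=> //; apply/concaveP => a p q p0 q0.
have gapB : gap m a p q = gap (stair i) a p q + gap (m `\` stair i) a p q.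
  by rewrite -gapD msetBDKC.
have [kink|nokink] := boolP (a < i.+1 < a + p + q)%N; last first.
  have := (concaveP m).1 mc a p q p0 q0.
  by rewrite gapB (gap_stair_eq0 nokink) add0r.
apply: (@lt_le_trans _ _ 0); first by lia.
have -> : gap (m `\` stair i) a p q = gap m a p q - gap (stair i) a p q by rewrite gapB addrC addKr.
rewrite (gap_expansion _ _ _ mr) -(sum_c (fun k : 'I_r => gap (stair k) a p q)).
by apply: ge0 => k; rewrite gap_stair_ge0 gap_stair_le.
Qed.

Lemma stair_le_of_curv r i (m : {mset nat}) :
    vars_below r m -> (forall k, (k < r)%N -> 0 <= curv m k) -> (i < r)%N -> 0 < curv m i ->
  stair i `<=` m.
Proof.
move=> mr m0 ir ci; apply/msubsetP => l; rewrite -lez_nat (curv_expansion _ mr).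
rewrite (bigD1 (Ordinal ir)) //=; apply: (@le_trans _ _ (curv m i * (stair i l)%:Z)).
  by rewrite ler_peMl //; lia.
by rewrite lerDl; apply: sumr_ge0 => k _; rewrite mulr_ge0 ?m0.
Qed.

(** * Monomials, truncation and polynomials inside power series *)

Definition monom (a : {mset nat}) : series := Mps (fun m => (m == a)%:R).

Lemma coef_mul_monom (f : series) (a m : {mset nat}) :
  (f * monom a) m = if a `<=` m then f (m `\` a) else 0.
Proof.
rewrite mulrC -[LHS]/(\sum_(b <- msubs m) (b == a)%:R * f (m `\` b)).
case: ifPn => am; last first.
  rewrite big_seq big1 // => b; rewrite in_msubs => bm.
  by case: eqP => [ba|_]; [rewrite ba (negPf am) in bm | rewrite mul0r].
rewrite (big_fsetD1 a) /= ?in_msubs // eqxx mul1r big_seq big1 ?addr0 // => b.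
by rewrite !inE => /andP[/negPf-> _]; rewrite mul0r.
Qed.

Lemma monom0 : monom mset0 = 1.
Proof. exact: mpsP. Qed.

Lemma monomM (a b : {mset nat}) : monom a * monom b = monom (a `+` b).
Proof.
apply: mpsP => m; rewrite coef_mul_monom /=; case: ifPn => [bm|nbm].
  congr (nat_of_bool _)%:R; apply/eqP/eqP => [<-|->]; last by rewrite msetDC msetDKB.
  by rewrite msetDC msetBDKC.
case: eqP nbm => // ->; case/negP; apply/msubsetP => i.
by rewrite msetE2 leq_addl.
Qed.

Lemma monom1 (i : nat) : 'x_i = monom [mset i].
Proof. by []. Qed.

Lemma monomXn (i n : nat) : 'x_i ^+ n = monom (msetn n i).
Proof.
elim: n => [|n IH]; first by rewrite expr0 msetn0 monom0.
rewrite exprS IH monom1 monomM; congr monom.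
by apply/msetP => j; rewrite msetE2 !msetnE; case: eqP.
Qed.

Lemma monom_prod (r : nat) (e : nat -> nat) :
  \prod_(i < r) 'x_i ^+ e i = monom (mset_of r e).
Proof.
elim: r => [|r IH].
  rewrite big_ord0 -monom0; congr monom.
  by apply/msetP => i; rewrite mset_ofE mset0E.
rewrite big_ord_recr /= IH monomXn monomM; congr monom.
apply/msetP => i; rewrite msetE2 !mset_ofE msetnE ltnS.
by case: (ltngtP i r) => [_|_|->]; rewrite ?addn0.
Qed.

Lemma denomE r : denom r = \prod_(i < r) (1 - monom (stair i)).
Proof. by apply: eq_bigr => i _; rewrite (monom_prod _ (fun j => i.+1 - j)%N). Qed.

Definition indicator (P : {mset nat} -> Prop) : series :=
  Mps (fun m => if `[< P m >] then 1 else 0).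

Lemma eq_indicator P Q : (forall m, P m <-> Q m) -> indicator P = indicator Q.
Proof. by move=> PQ; apply: mpsP => m /=; rewrite (asbool_equiv_eq (PQ m)). Qed.

Lemma indicatorE (P : {mset nat} -> Prop) m : P m -> indicator P m = 1.
Proof. by move=> Pm /=; rewrite asboolT. Qed.

Lemma indicatorN (P : {mset nat} -> Prop) m : ~ P m -> indicator P m = 0.
Proof. by move=> Pm /=; rewrite asboolF. Qed.

Lemma coef_peel (f : series) (a m : {mset nat}) :
  (f * (1 - monom a)) m = f m - (if a `<=` m then f (m `\` a) else 0).
Proof. by rewrite mulrBr mulr1 -coef_mul_monom. Qed.

(** Stability under adding [v] makes every subtracted term cancel a term of the
series, so the product is again the indicator of a set. *)
Lemma indicator_peel (P : {mset nat} -> Prop) (v : {mset nat}) :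
    (forall m, P m -> P (v `+` m)) ->
  indicator P * (1 - monom v) =
  indicator (fun m => P m /\ ~ (v `<=` m /\ P (m `\` v))).
Proof.
move=> Pv; apply: mpsP => m; rewrite coef_peel.
case: ifPn => [vm|nvm]; last first.
  rewrite subr0 /=; congr (if _ then _ else _); apply: asbool_equiv_eq.
  by split=> [Pm|[]//]; split=> // -[vm]; rewrite vm in nvm.
have [Pmv|nPmv] := EM (P (m `\` v)).
  have Pm : P m by rewrite -(msetBDKC vm); apply: Pv.
  by rewrite (indicatorE Pm) (indicatorE Pmv) indicatorN ?subrr //; case=> _; apply.
rewrite (indicatorN nPmv) subr0; congr (if _ then _ else _); apply: asbool_equiv_eq.
by split=> [Pm|[]//]; split=> // -[].
Qed.

Lemma coef_trunc r (f : series) m : mps_trunc r f m = if vars_below r m then f m else 0.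
Proof. by []. Qed.

Fact mps_trunc_is_zmod_morphism r : zmod_morphism (mps_trunc r).
Proof.
move=> f g; apply: mpsP => m; rewrite [RHS]/(mps_trunc r f m - mps_trunc r g m) !coef_trunc.
by case: ifP; rewrite ?subrr.
Qed.

Fact mps_trunc_is_monoid_morphism r : monoid_morphism (mps_trunc r).
Proof.
split=> [|f g]; apply: mpsP => m; rewrite !coef_trunc.
  rewrite -monom0 /=; case: ifPn => // nm; case: eqP nm => // -> /vars_belowP[] i _.
  exact: mset0E.
rewrite -[RHS]/(\sum_(a <- msubs m) _).
case: ifPn => [mr|nmr].
  rewrite -[LHS]/(\sum_(a <- msubs m) _) big_seq [RHS]big_seq; apply: eq_bigr => a.
  rewrite in_msubs => am; move: mr; rewrite -(msetBDKC am) vars_belowD => /andP[ar mar].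
  by rewrite !coef_trunc ar msetBDKC // mar.
rewrite big_seq big1 // => a; rewrite in_msubs => am; rewrite !coef_trunc.
move: nmr; rewrite -{1}(msetBDKC am) vars_belowD negb_and.
by case/orP => /negPf->; rewrite ?mul0r ?mulr0.
Qed.

HB.instance Definition _ r := GRing.isZmodMorphism.Build series series
  (mps_trunc r) (mps_trunc_is_zmod_morphism r).
HB.instance Definition _ r := GRing.isMonoidMorphism.Build series series
  (mps_trunc r) (mps_trunc_is_monoid_morphism r).

Lemma trunc_monom r (a : {mset nat}) :
  mps_trunc r (monom a) = if vars_below r a then monom a else 0.
Proof.
apply: mpsP => m; rewrite coef_trunc.
have [ar|nar] := boolP (vars_below r a); case: ifPn => // mr /=.
  by case: eqP mr => // ->; rewrite ar.
by case: eqP mr nar => // -> ->.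
Qed.

Lemma trunc_peel r (a : {mset nat}) :
  mps_trunc r (1 - monom a) = if vars_below r a then 1 - monom a else 1.
Proof.
rewrite -monom0 rmorphB /= !trunc_monom ifT; last by apply/vars_belowP => i _; exact: mset0E.
by case: ifP; rewrite ?subr0.
Qed.

Lemma trunc_denom r n : (r <= n)%N -> mps_trunc r (denom n) = denom r.
Proof.
move=> rn; rewrite !denomE rmorph_prod /=.
rewrite [RHS](big_ord_widen _ (fun i => 1 - monom (stair i)) rn) [RHS]big_mkcond /=.
apply: eq_bigr => i _; rewrite trunc_peel.
case: ltnP => ir; first by rewrite stair_below.
rewrite (_ : vars_below r (stair i) = false) //.
by apply/negP => /vars_belowP/(_ i ir); rewrite stairE subSnn.
Qed.

Lemma trunc_trunc r n (f : series) : (r <= n)%N ->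
  mps_trunc r (mps_trunc n f) = mps_trunc r f.
Proof.
move=> rn; apply: mpsP => m; rewrite !coef_trunc; case: ifPn => // /vars_belowP mr.
by rewrite ifT //; apply/vars_belowP => i ni; apply: mr; apply: leq_trans ni.
Qed.

(** A name for the coefficient functional, so that it can carry the structure of
an additive map and commute with finite sums. *)
Definition coef_at (m : {mset nat}) (f : series) : int := f m.

Fact coef_at_is_zmod_morphism m : zmod_morphism (coef_at m).
Proof. by []. Qed.

HB.instance Definition _ m := GRing.isZmodMorphism.Build series int
  (coef_at m) (coef_at_is_zmod_morphism m).

HB.instance Definition _ r := GRing.RMorphism.copy (@mps_of_mpoly r)
  (mmap intr (fun i : 'I_r => 'x_i)).

Definition mset_of_mnm (r : nat) (k : 'X_{1..r}) : {mset nat} := mset_of r (nth 0%N k).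

Lemma mset_of_mnmE r (k : 'X_{1..r}) (i : 'I_r) : mset_of_mnm k i = k i.
Proof. by rewrite mset_ofE ltn_ord (mnm_nth 0%N). Qed.

Lemma mset_of_mnm_below r (k : 'X_{1..r}) : vars_below r (mset_of_mnm k).
Proof. by apply/vars_belowP => i ri; rewrite mset_ofE ltnNge ri. Qed.

Lemma mset_of_mnmK r (m : {mset nat}) : vars_below r m ->
  mset_of_mnm [multinom m i | i < r] = m.
Proof.
move/vars_belowP=> mr; apply/msetP => i; have [ri|ir] := leqP r i.
  by rewrite mr // mset_ofE ltnNge ri.
by rewrite -[i in LHS]/(nat_of_ord (Ordinal ir)) mset_of_mnmE mnmE.
Qed.

Lemma coef_of_mpoly r (p : {mpoly int[r]}) (m : {mset nat}) :
  mps_of_mpoly p m = if vars_below r m then p@_[multinom m i | i < r] else 0.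
Proof.
rewrite -[LHS]/(coef_at m _) /mps_of_mpoly /mmap raddf_sum /=.
have E (k : 'X_{1..r}) : coef_at m ((p@_k)%:~R * mmap1 (fun i : 'I_r => 'x_i) k) =
    p@_k * (m == mset_of_mnm k)%:R.
  rewrite mulrzl raddfMz /= /mmap1 -mulrzl intz; congr (_ * _).
  rewrite (eq_bigr (fun i : 'I_r => 'x_i ^+ nth 0%N k i)) => [|i _].
    by rewrite (monom_prod _ (nth 0%N k)).
  by rewrite (mnm_nth 0%N).
rewrite (eq_bigr _ (fun k _ => E k)); case: ifPn => [mr|nmr]; last first.
  rewrite big1 // => k _; case: eqP nmr => [->|_]; last by rewrite mulr0.
  by rewrite mset_of_mnm_below.
rewrite [in RHS](mpolyE p) raddf_sum /=; apply: eq_bigr => k _.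
rewrite mcoeffZ mcoeffX; congr (_ * (nat_of_bool _)%:R); apply/eqP/eqP => [->|->].
  by apply/mnmP => i; rewrite mnmE mset_of_mnmE.
by rewrite mset_of_mnmK.
Qed.

Lemma mps_of_mpoly_inj r : injective (@mps_of_mpoly r).
Proof.
move=> p q pq; apply/mpolyP => k.
have := congr1 (fun f : series => f (mset_of_mnm k)) pq.
rewrite !coef_of_mpoly mset_of_mnm_below.
rewrite (_ : [multinom mset_of_mnm k i | i < r] = k) //.
by apply/mnmP => i; rewrite mnmE mset_of_mnmE.
Qed.

Lemma mps_of_mpoly_surj r B (f : series) : mps_trunc r f = f ->
    (forall m, f m != 0 -> forall i, (m i <= B)%N) ->
  exists p : {mpoly int[r]}, mps_of_mpoly p = f.
Proof.
move=> fr fB; pose E (k : 'X_{1..r}) := f (mset_of_mnm k).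
exists (\sum_(k : 'X_{1..r < (r * B).+1}) E k *: 'X_[k]).
apply: mpsP => m; rewrite coef_of_mpoly -[in RHS]fr coef_trunc; case: ifP => // mr.
have [lt_m|le_m] := ltnP (mdeg [multinom m i | i < r]) (r * B).+1.
  by rewrite mcoeff_mpoly // /E mset_of_mnmK.
have -> : f m = 0.
  apply: contraTeq le_m => /fB mB; rewrite -ltnNge ltnS mdegE.
  apply: (@leq_trans (\sum_(i < r) B)); last by rewrite sum_nat_const card_ord.
  by apply: leq_sum => i _; rewrite mnmE.
rewrite raddf_sum /= big1 // => k _; rewrite mcoeffZ mcoeffX.
case: eqP => [km|_]; last by rewrite mulr0.
by have := bmdeg k; rewrite km ltnNge le_m.
Qed.

Lemma mps_of_mpoly_comp r (p : {mpoly int[r.+1]}) :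
  mps_of_mpoly (p \mPo [tuple of rcons [tuple 'X_i | i < r] 0]) =
  mps_trunc r (mps_of_mpoly p).
Proof.
rewrite [in RHS]/mps_of_mpoly /comp_mpoly /mmap !rmorph_sum; apply: eq_bigr => k _.
rewrite !rmorphM /= rmorph_int [mps_of_mpoly _]mmapC; congr (_ * _).
rewrite /mmap1 !rmorph_prod; apply: eq_bigr => i _; rewrite !rmorphXn /=; congr (_ ^+ _).
rewrite trunc_monom (tnth_nth 0) /= nth_rcons size_map size_enum_ord.
have [ir|ri] := ltnP i r.
  rewrite (nth_map (Ordinal ir)) ?size_enum_ord //.
  rewrite [mps_of_mpoly _]mmapX mmap1U (_ : nat_of_ord (nth _ _ _) = i); last first.
    by rewrite nth_enum_ord.
  rewrite ifT //; apply/vars_belowP => j rj; rewrite msetnE; case: eqP => // ji.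
  by move: ir; rewrite -ji ltnNge rj.
rewrite if_same rmorph0 ifF //; apply/negP => /vars_belowP/(_ i ri).
by rewrite msetnxx.
Qed.

(** * The numerator is a polynomial *)

Definition convex_upto (r k : nat) (m : {mset nat}) : Prop :=
  [/\ vars_below r m, concave m & forall i, (i < k)%N -> 0 <= curv m i].

Definition first_dent (r k : nat) (m : {mset nat}) : Prop :=
  convex_upto r k m /\ curv m k = -1.

(** What remains of the convex sequences after the first [k] factors of the
denominator have been multiplied in. *)
Definition convex_from (r k : nat) (m : {mset nat}) : Prop :=
  convex_upto r r m /\ forall i, (i < k)%N -> curv m i = 0.

Lemma convex_uptoD_stair r k i (m : {mset nat}) : (i < r)%N ->
  convex_upto r k m -> convex_upto r k (stair i `+` m).
Proof.
move=> ir [mr mc m0]; split; first by rewrite vars_belowD stair_below.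
  exact: concaveD_stair.
by move=> j jk; rewrite curvD curv_stair addr_ge0 ?m0.
Qed.

Lemma indicator_convex_upto0 r : indicator (convex_upto r 0) = PC_ r.
Proof.
apply: mpsP => m; rewrite coef_trunc; case: ifPn => mr /=; last first.
  by rewrite asboolF // => -[]; rewrite (negPf mr).
by congr (if _ then _ else _); apply: asbool_equiv_eq; split=> [[]|].
Qed.

Lemma indicator_convex_uptoS r k :
  indicator (convex_upto r k) = indicator (convex_upto r k.+1) + indicator (first_dent r k).
Proof.
apply: mpsP => m; rewrite [RHS]/(indicator _ m + indicator _ m).
have [mk|nmk] := EM (convex_upto r k m); last first.
  rewrite !indicatorN ?addr0 // => [[] //|[mr mc m0]].
  by apply: nmk; split=> // i ik; apply/m0/ltnW.
have [mr mc m0] := mk; rewrite (indicatorE mk).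
have [ck|ck] := leP 0 (curv m k).
  have mk' : convex_upto r k.+1 m.
    by split=> // i; rewrite ltnS leq_eqVlt => /predU1P[->|/m0].
  by rewrite (indicatorE mk') indicatorN ?addr0 // => -[_ E]; rewrite E in ck.
have dent : first_dent r k m by split=> //; have := concave_curv k mc; lia.
rewrite (indicatorE dent) indicatorN ?add0r // => -[_ _ /(_ k (ltnSn k))].
by rewrite leNgt ck.
Qed.

(** Peeling off the factor of [stair k] fixes the [k]-th coordinate to [0]: a
nonnegative combination with a positive [k]-th coordinate remains one after
subtraction of [stair k]. *)
Lemma indicator_convex_fromS r k : (k < r)%N ->
  indicator (convex_from r k) * (1 - monom (stair k)) = indicator (convex_from r k.+1).
Proof.
move=> kr; apply: mpsP => m; rewrite coef_peel.
have [mk|nmk] := EM (convex_from r k m); last first.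
  rewrite (indicatorN nmk) [RHS]indicatorN => [|[mr m0]]; last first.
    by apply: nmk; split=> // i ik; apply/m0/ltnW.
  case: ifP => km; rewrite ?subr0 // indicatorN ?subr0 // => -[mr m0]; apply: nmk.
  rewrite -(msetBDKC km); split; first exact: convex_uptoD_stair.
  by move=> i ik; rewrite curvD curv_stair m0 // (ltn_eqF ik).
have [[mr mc mge0] m0] := mk; rewrite indicatorE //.
have := mge0 k kr; rewrite le_eqVlt => /predU1P[/esym ck|ck].
  rewrite [RHS]indicatorE; last by split=> // i; rewrite ltnS leq_eqVlt => /predU1P[->|/m0].
  case: ifPn => km; rewrite ?subr0 // indicatorN ?subr0 // => -[[_ _ /(_ k kr)]] + _.
  by move: ck; rewrite (curvB_stair k km) eqxx; lia.
rewrite [RHS]indicatorN => [|[_ /(_ k (ltnSn k))]]; last by move=> E; rewrite E in ck.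
have km := stair_le_of_curv mr mge0 kr ck; rewrite km indicatorE ?subrr //.
have mr' : vars_below r (m `\` stair k).
  by move: mr; rewrite -{1}(msetBDKC km) vars_belowD => /andP[].
have cB i : (i < r)%N -> 0 <= curv (m `\` stair k) i.
  move=> ir; have := mge0 i ir; rewrite (curvB_stair _ km).
  case: eqP => [->|_]; last by rewrite add0r.
  by move: ck; rewrite (curvB_stair _ km) eqxx ltz1D.
split; first by split=> //; exact: concave_curv_ge0 cB.
by move=> i ik; have := m0 i ik; rewrite (curvB_stair _ km) (ltn_eqF ik) add0r.
Qed.

Lemma curv_eq0 r (m : {mset nat}) :
  vars_below r m -> (forall i, (i < r)%N -> curv m i = 0) -> m = mset0.
Proof.
move=> mr m0; apply/msetP => i; rewrite mset0E.
suff: (m i)%:Z = 0 by case.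
by rewrite (curv_expansion _ mr) big1 // => k _; rewrite m0 ?mul0r.
Qed.

(** The convex sequences form the free commutative monoid on the staircases. *)
Lemma convex_series r : indicator (convex_upto r r) * denom r = 1.
Proof.
have step k : (k <= r)%N ->
    indicator (convex_upto r r) * \prod_(i < k) (1 - monom (stair i)) =
    indicator (convex_from r k).
  elim: k => [|k IH] kr.
    by rewrite big_ord0 mulr1; apply: eq_indicator => m; split=> [|[]].
  by rewrite big_ord_recr mulrA IH ?indicator_convex_fromS // ltnW.
rewrite denomE step // -monom0; apply: mpsP => m.
rewrite [RHS]/((m == mset0)%:R); case: eqP => [->|nm].
  have c0 i : curv mset0 i = 0 by rewrite /curv !mset0E.
  have r0 : vars_below r mset0 by apply/vars_belowP => i _; exact: mset0E.
  rewrite indicatorE //; split=> //.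
  by split=> // [|i _]; [apply: (concave_curv_ge0 r0) => i _|]; rewrite c0.
by rewrite indicatorN // => -[[mr _ _] m0]; apply: nm; exact: curv_eq0 mr m0.
Qed.

(** The support of the series is bounded in the [i]-th coordinate. Factors of
the other staircases do not move this coordinate, so the bounds for different
[i] can be established one factor at a time. *)
Definition curv_bounded (i : nat) (b : int) (f : series) : Prop :=
  forall m, b <= curv m i -> f m = 0.

Lemma curv_bounded_peel i b k (f : series) : i != k ->
  curv_bounded i b f -> curv_bounded i b (f * (1 - monom (stair k))).
Proof.
move=> ik fb m bm; rewrite coef_peel fb //; case: ifP => km; rewrite ?subr0 //.
by rewrite fb ?subr0 //; move: bm; rewrite (curvB_stair _ km) (negPf ik) add0r.
Qed.

Lemma curv_bounded_peels r i b (f : series) (P : pred 'I_r) :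
    (forall k, P k -> i != k :> nat) -> curv_bounded i b f ->
  curv_bounded i b (f * \prod_(k < r | P k) (1 - monom (stair k))).
Proof.
move=> Pi fb; elim/big_rec: _ => [|k g Pk IH]; first by rewrite mulr1.
by rewrite mulrCA mulrC; apply: curv_bounded_peel => //; exact: Pi.
Qed.

(** Subtracting [stair i] from a member with large [i]-th coordinate yields
another member, so the terms cancel in pairs. *)
Lemma first_dent_peel r k i : (i < r)%N -> i != k ->
  curv_bounded i (curv_bound r) (indicator (first_dent r k) * (1 - monom (stair i))).
Proof.
move=> ir ik m bm; rewrite indicator_peel => [|n [nk ck]]; last first.
  by split; [exact: convex_uptoD_stair|rewrite curvD curv_stair eq_sym (negPf ik) add0r].
rewrite indicatorN // => -[[[mr mc m0] ck]]; apply.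
have [km mc'] := concaveB_stair mr mc ir bm; split=> //; split; last first.
  by move: ck; rewrite (curvB_stair _ km) eq_sym (negPf ik) add0r.
split=> // [|j jk].
  by move: mr; rewrite -{1}(msetBDKC km) vars_belowD => /andP[].
have := m0 j jk; rewrite (curvB_stair _ km); case: eqP => [->|_]; last by rewrite add0r.
by move: bm; rewrite (curvB_stair _ km) eqxx /curv_bound; lia.
Qed.

(** Bounds on all coordinates bound the entries, because the staircases are
nonnegative. *)
Lemma curv_bounded_mpoly r b (f : series) : mps_trunc r f = f ->
    (forall i, (i < r)%N -> curv_bounded i b f) ->
  exists p : {mpoly int[r]}, mps_of_mpoly p = f.
Proof.
move=> fr fb; apply: (@mps_of_mpoly_surj r (`|b| * r * r)) => // m fm i.
have mr : vars_below r m by apply: contraNT fm => nmr; rewrite -fr coef_trunc (negPf nmr).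
rewrite -lez_nat (curv_expansion _ mr); apply: (@le_trans _ _ (\sum_(k < r) (`|b| * r)%N%:Z)).
  apply: ler_sum => k _; apply: (@le_trans _ _ (`|b|%N%:Z * (stair k i)%:Z)).
    apply: ler_wpM2r => //; apply: (@le_trans _ _ b); last by lia.
    by rewrite leNgt; apply/negP => /ltW /(fb _ (ltn_ord k)) /eqP; rewrite (negPf fm).
  by rewrite PoszM; apply: ler_wpM2l => //; rewrite lez_nat stairE; have := ltn_ord k; lia.
by rewrite sumr_const card_ord -mulr_natr natz -PoszM.
Qed.

Lemma trunc_indicator r (P : {mset nat} -> Prop) :
  (forall m, P m -> vars_below r m) -> mps_trunc r (indicator P) = indicator P.
Proof.
move=> Pr; apply: mpsP => m; rewrite coef_trunc; case: ifPn => // /negP mr.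
by rewrite indicatorN // => /Pr.
Qed.

(** The factor of [stair k] can be left out because the [k]-th coordinate of a
member is [-1]. *)
Lemma first_dent_mpoly r (k : 'I_r) : exists p : {mpoly int[r]},
  mps_of_mpoly p = indicator (first_dent r k) * \prod_(i < r | i != k) (1 - monom (stair i)).
Proof.
apply: (@curv_bounded_mpoly r (curv_bound r)).
  rewrite rmorphM rmorph_prod /=; congr (_ * _).
    by apply: trunc_indicator => m [[]].
  by apply: eq_bigr => i _; rewrite trunc_peel stair_below.
move=> i ir; have [->|ik] := eqVneq i k.
  apply: curv_bounded_peels => [j|m bm]; first by rewrite eq_sym.
  by rewrite indicatorN // => -[_ ck]; move: bm; rewrite ck /curv_bound.
rewrite (bigD1 (Ordinal ir)) //= mulrA.
apply: curv_bounded_peels => [j /andP[_]|]; first by rewrite eq_sym.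
exact: first_dent_peel.
Qed.

(** Moving one class [first_dent r k] at a time out of [PC_ r], the numerator
changes by [(1 - x^(v_k)) p_k], which vanishes at [(1, ..., 1)]. *)
Lemma PC_numerator r : exists p : {mpoly int[r]},
  mps_of_mpoly p = PC_ r * denom r /\ p.@[fun _ => 1] = 1.
Proof.
pose x k : {mpoly int[r]} := 'X_[[multinom stair k i | i < r]].
have xE (k : 'I_r) : mps_of_mpoly (1 - x k) = 1 - monom (stair k).
  rewrite rmorphB rmorph1 /=; congr (_ - _); rewrite [LHS]mmapX /mmap1.
  rewrite (eq_bigr (fun i : 'I_r => 'x_i ^+ stair k i)) => [|i _]; last by rewrite mnmE.
  rewrite monom_prod; congr monom; apply/msetP => i; rewrite mset_ofE.
  by case: ltnP => // ri; rewrite (vars_belowP _ _ (stair_below (ltn_ord k))).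
have step k : (k <= r)%N -> exists p : {mpoly int[r]},
    mps_of_mpoly p = PC_ r * denom r - indicator (convex_upto r k) * denom r /\
    p.@[fun _ => 1] = 0.
  elim: k => [|k IH] kr.
    by exists 0; rewrite rmorph0 meval0 indicator_convex_upto0 subrr.
  have [p [pE p1]] := IH (ltnW kr).
  have [q qE] := first_dent_mpoly (Ordinal kr).
  exists (p + (1 - x k) * q); split.
    rewrite rmorphD rmorphM /= pE qE (xE (Ordinal kr)) indicator_convex_uptoS.
    by rewrite denomE (bigD1 (Ordinal kr)) //=; ring.
  rewrite mevalD mevalM mevalB meval1 mevalX p1 big1 ?subrr ?mul0r ?addr0 // => i _.
  exact: expr1n.
have [p [pE p1]] := step r (leqnn r).
exists (p + 1); rewrite rmorphD rmorph1 /= pE convex_series subrK; split=> //.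
by rewrite mevalD meval1 p1 add0r.
Qed.

Lemma partition_support_peel k (f : series) :
    (forall m, f m != 0 -> is_partition m) ->
  forall m, (f * (1 - monom (stair k))) m != 0 -> is_partition m.
Proof.
move=> fp m; rewrite coef_peel; have [->|/fp mp _] := eqVneq (f m) 0; last exact: mp.
case: ifP => km; last by rewrite subr0 eqxx.
rewrite -(msetBDKC km) msetDKB sub0r oppr_eq0.
move: (m `\` stair k) => n /fp mp i j ij; rewrite !msetE2.
by apply: leq_add; [rewrite !stairE; lia | exact: mp].
Qed.

Lemma numerator_support r (m : {mset nat}) : (PC_ r * denom r) m != 0 -> is_partition m.
Proof.
rewrite denomE; move: m; elim/big_rec: _ => [|k g _ IH].
  rewrite mulr1 => m; rewrite coef_trunc; case: ifP => // _ /=.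
  by case: asboolP => [[]|].
by move=> m; rewrite mulrCA mulrC; exact: partition_support_peel.
Qed.

(** * Passing to infinitely many variables *)

Lemma coef_of_trunc r (f : series) (m : {mset nat}) :
  vars_below r m -> f m = mps_trunc r f m.
Proof. by move=> mr; rewrite coef_trunc mr. Qed.

(** A monomial involves finitely many variables, so a series is the limit of any
sequence that is compatible with the truncations. *)
Lemma mps_cvg_trunc (u : nat -> series) (f : series) :
  (forall n, mps_trunc n f = mps_trunc n (u n)) ->
  (forall r n, (r <= n)%N -> mps_trunc r (u n) = mps_trunc r (u r)) -> mps_cvg u f.
Proof.
move=> fu ur m; have [r mr] := exists_vars_below m; exists r => n rn.
by rewrite (coef_of_trunc (u n) mr) ur // -fu -coef_of_trunc.
Qed.

(** The coefficient at [m] is read off from any denominator that has all the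
variables of [m]. *)
Lemma denom_limit : exists D : series, forall r, mps_trunc r D = denom r.
Proof.
pose N (m : {mset nat}) := xchoose (exists_vars_below m).
exists (Mps (fun m => denom (N m) m)) => r; apply: mpsP => m.
rewrite -[in RHS](trunc_denom (leqnn r)) !coef_trunc; case: ifPn => // mr /=.
have Nm : vars_below (N m) m := xchooseP (exists_vars_below m).
rewrite (coef_of_trunc (denom (N m)) mr) (coef_of_trunc (denom r) Nm).
case: (leqP r (N m)) => h.
  by rewrite (trunc_denom h) coef_trunc Nm.
by rewrite (trunc_denom (ltnW h)) coef_trunc mr.
Qed.

Theorem theorem10 :
  exists Q : forall r : nat, {mpoly int[r]},
  [/\ Q 0%N = 1,
      forall r : nat, (0 < r)%N ->
        [/\ PC_ r = mps_of_mpoly (Q r) / denom r,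
            (Q r).@[fun _ : 'I_r => 1] = 1,
            forall m : 'X_{1..r}, m \in msupp (Q r) ->
              forall i j : 'I_r, (i <= j)%N -> (m j <= m i)%N
          & Q r = Q r.+1 \mPo [tuple of rcons [tuple 'X_i | i < r] 0]]
    & exists Qoo Doo : series,
      [/\ mps_cvg denom Doo,
          PC = Qoo / Doo,
          forall l : nat, (0 < l)%N -> mps_trunc l Qoo = mps_of_mpoly (Q l)
        & mps_cvg
            (fun n => 1 + \sum_(i < n) (mps_of_mpoly (Q i.+1) - mps_of_mpoly (Q i)))
            Qoo]].
Proof.
pose Q r := projT1 (cid (PC_numerator r)).
have QE r : mps_of_mpoly (Q r) = PC_ r * denom r by case: (projT2 (cid (PC_numerator r))).
have trunc_PC r n : (r <= n)%N -> mps_trunc r (PC_ n) = PC_ r by exact: trunc_trunc.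
have trunc_Q r n : (r <= n)%N -> mps_trunc r (mps_of_mpoly (Q n)) = mps_of_mpoly (Q r).
  by move=> rn; rewrite !QE rmorphM /= trunc_denom // trunc_PC.
have Q0 : Q 0%N = 1.
  apply: mps_of_mpoly_inj; rewrite rmorph1 QE -indicator_convex_upto0.
  exact: convex_series.
exists Q; split=> // [r r0|].
  split=> [|||].
  - by rewrite QE mulrK // denom_unit.
  - by case: (projT2 (cid (PC_numerator r))).
  - move=> m; rewrite mcoeff_msupp => Qm i j ij; rewrite -!mset_of_mnmE.
    apply: (@numerator_support r) => //; rewrite -QE coef_of_mpoly mset_of_mnm_below.
    rewrite (_ : [multinom _ | _ < _] = m) //.
    by apply/mnmP => l; rewrite mnmE mset_of_mnmE.
  - by apply: mps_of_mpoly_inj; rewrite mps_of_mpoly_comp trunc_Q.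
have [D DE] := denom_limit; exists (PC * D), D.
have Dcvg : mps_cvg denom D.
  by apply: mps_cvg_trunc => [n|r n rn]; rewrite ?DE !trunc_denom.
have truncQ r : mps_trunc r (PC * D) = mps_of_mpoly (Q r).
  by rewrite rmorphM /= DE QE.
split=> //.
  by rewrite mulrK //; exact: denom_lim_unit Dcvg.
have telescope n : 1 + \sum_(i < n) (mps_of_mpoly (Q i.+1) - mps_of_mpoly (Q i)) =
    mps_of_mpoly (Q n).
  rewrite -(big_mkord xpredT (fun i => mps_of_mpoly (Q i.+1) - mps_of_mpoly (Q i))).
  by rewrite telescope_sumr // Q0 rmorph1 addrC subrK.
apply: mps_cvg_trunc => [n|r n rn]; rewrite !telescope trunc_Q //.
by rewrite trunc_Q.
Qed.
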